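(* Let $n\ge 0$ be an integer and let $r,k\in\mathbb{Z}$. Then, as polynomials in $x$, $$A_{n}^{(r,k)}(x)=\sum_{m=0}^{n}(-1)^{m}\binom{n}{m}A_{n-m}^{(r,k)}\,x^{(m)},$$ where $x^{(m)}=x(x+1)\cdots(x+m-1)$ is the rising factorial (with $x^{(0)}=1$).
   Context: All generating functions are formal power series in $t$. For $k\in\mathbb{Z}$, put $\mathrm{Lif}_k(t)=\sum_{n\ge 0}\frac{t^n}{n!(n+1)^k}$. For $r,k\in\mathbb{Z}$, the polynomials $A_n^{(r,k)}(x)\in\mathbb{C}[x]$ are defined by $$\left(\frac{t}{\log(1+t)}\right)^{r}\frac{\mathrm{Lif}_k(\log(1+t))}{(1+t)^{x}}=\sum_{n\ge 0}A_n^{(r,k)}(x)\frac{t^n}{n!},$$ and $A_n^{(r,k)}=A_n^{(r,k)}(0)$. *)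

(* Defs.v *)
From HB Require Import structures.
From mathcomp Require Import all_boot all_order all_algebra.
From mathcomp Require Import boolp.

Set Implicit Arguments.
Unset Strict Implicit.
Unset Printing Implicit Defensive.

Import GRing.Theory.
Local Open Scope ring_scope.

(* Formal power series over A, given by their sequence of coefficients. *)
Record fps (A : Type) := FPS { fpscoef : nat -> A }.

Lemma fpsP (A : Type) (f g : fps A) : fpscoef f =1 fpscoef g <-> f = g.
Proof.
by split=> [|-> //]; case: f g => f [g] /= fg; congr FPS; exact/funext.
Qed.

HB.instance Definition _ (A : Type) := gen_eqMixin (fps A).
HB.instance Definition _ (A : Type) := gen_choiceMixin (fps A).

Section FpsZmodule.
Context {A : zmodType}.
Implicit Types f g h : fps A.

Definition fps_zero : fps A := FPS (fun=> 0).
Definition fps_opp f : fps A := FPS (fun n => - fpscoef f n).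
Definition fps_add f g : fps A := FPS (fun n => fpscoef f n + fpscoef g n).

Fact fps_addA : associative fps_add.
Proof. by move=> f g h; apply/fpsP => n /=; rewrite addrA. Qed.
Fact fps_addC : commutative fps_add.
Proof. by move=> f g; apply/fpsP => n /=; rewrite addrC. Qed.
Fact fps_add0 : left_id fps_zero fps_add.
Proof. by move=> f; apply/fpsP => n /=; rewrite add0r. Qed.
Fact fps_addN : left_inverse fps_zero fps_opp fps_add.
Proof. by move=> f; apply/fpsP => n /=; rewrite addNr. Qed.

HB.instance Definition _ :=
  GRing.isZmodule.Build (fps A) fps_addA fps_addC fps_add0 fps_addN.

End FpsZmodule.

Section FpsRing.
Context {A : comNzRingType}.
Implicit Types f g h : fps A.

Definition fps_one : fps A := FPS (fun n => (n == 0%N)%:R).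
Definition fps_mul f g : fps A :=
  FPS (fun n => \sum_(i < n.+1) fpscoef f i * fpscoef g (n - i)).

Definition fps_trunc N f : {poly A} := \poly_(i < N) fpscoef f i.

Lemma coef_fps_trunc N f i :
  (i < N)%N -> (fps_trunc N f)`_i = fpscoef f i.
Proof. by move=> iN; rewrite coef_poly iN. Qed.

Lemma fps_mul_trunc N f g n : (n < N)%N ->
  fpscoef (fps_mul f g) n = (fps_trunc N f * fps_trunc N g)`_n.
Proof.
move=> nN; rewrite coefM; apply: eq_bigr => i _.
rewrite !coef_fps_trunc // (leq_ltn_trans _ nN) //; first exact: leq_subr.
by rewrite -ltnS.
Qed.

Fact fps_mulC : commutative fps_mul.
Proof.
by move=> f g; apply/fpsP => n; rewrite !(@fps_mul_trunc n.+1) // mulrC.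
Qed.

Fact fps_mulA : associative fps_mul.
Proof.
move=> f g h; apply/fpsP => n.
have -> : fpscoef (fps_mul f (fps_mul g h)) n =
    (fps_trunc n.+1 f * (fps_trunc n.+1 g * fps_trunc n.+1 h))`_n.
  rewrite coefM; apply: eq_bigr => i _; rewrite coef_fps_trunc //.
  by rewrite -fps_mul_trunc // ltnS leq_subr.
rewrite mulrA coefM; apply: eq_bigr => i _.
by rewrite -fps_mul_trunc // coef_fps_trunc // ltnS leq_subr.
Qed.

Fact fps_mul1 : left_id fps_one fps_mul.
Proof.
move=> f; apply/fpsP => n /=; rewrite big_ord_recl /= mul1r subn0 big1 ?addr0 //.
by move=> i _; rewrite mul0r.
Qed.

Fact fps_mulDl : left_distributive fps_mul +%R.
Proof.
move=> f g h; apply/fpsP => n /=; rewrite -big_split /=.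
by apply: eq_bigr => i _; rewrite mulrDl.
Qed.

Fact fps_one_neq0 : fps_one != 0.
Proof.
apply/eqP => /fpsP/(_ 0%N) /= /eqP; by rewrite oner_eq0.
Qed.

HB.instance Definition _ := GRing.Zmodule_isComNzRing.Build (fps A)
  fps_mulA fps_mulC fps_mul1 fps_mulDl fps_one_neq0.

Definition fpsC (c : A) : fps A := FPS (fun n => if n is 0 then c else 0).
Definition fpsX : fps A := FPS (fun n => (n == 1%N)%:R).

(* f(g(t)); this is the composition only when g has zero constant term, in
   which case g ^+ i contributes to the coefficient of t^n only for i <= n. *)
Definition fps_comp f g : fps A :=
  FPS (fun n => \sum_(i < n.+1) fpscoef f i * fpscoef (g ^+ i) n).

Lemma fpscoefD f g n : fpscoef (f + g) n = fpscoef f n + fpscoef g n.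
Proof. by []. Qed.

Lemma fpscoef1 n : fpscoef (1 : fps A) n = (n == 0%N)%:R.
Proof. by []. Qed.

Lemma fpscoefM f g n :
  fpscoef (f * g) n = \sum_(i < n.+1) fpscoef f i * fpscoef g (n - i).
Proof. by []. Qed.

Lemma fpscoef_sum (I : Type) (s : seq I) (P : pred I) (F : I -> fps A) n :
  fpscoef (\sum_(i <- s | P i) F i) n = \sum_(i <- s | P i) fpscoef (F i) n.
Proof. by elim/big_rec2: _ => // i a b _ <-. Qed.

Lemma fpscoef_exp_small g i n :
  fpscoef g 0 = 0 -> (n < i)%N -> fpscoef (g ^+ i) n = 0.
Proof.
move=> g0; elim: i n => // i IH n ni; rewrite exprS fpscoefM.
apply: big1 => -[[|j] /= jn] _; first by rewrite g0 mul0r.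
rewrite IH ?mulr0 //.
case: n ni jn => // n; rewrite !ltnS subSS => ni _.
exact: leq_ltn_trans (leq_subr _ _) ni.
Qed.

End FpsRing.

Section FpsUnitRing.
Context {A : comUnitRingType}.
Implicit Types f g : fps A.

Definition fps_unit : {pred fps A} := fun f => fpscoef f 0 \is a GRing.unit.

(* For c the constant term of f, the inverse is
   c^-1 * \sum_i (1 - c^-1 * f)^i. *)
Definition fps_inv f : fps A :=
  if fps_unit f then
    let c := fpsC (fpscoef f 0)^-1 in c * fps_comp (FPS (fun=> 1)) (1 - c * f)
  else f.

Fact fps_mulVx : {in fps_unit, left_inverse 1 fps_inv *%R}.
Proof.
move=> f fU; rewrite /fps_inv; move: (fU); rewrite unfold_in => fU'.
rewrite ifT //=; set c := fpsC _.
set u := 1 - c * f.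
have u0 : fpscoef u 0 = 0.
  by rewrite /u /= big_ord_recl big_ord0 /= addr0 mulVr // subrr.
have -> : c * fps_comp (FPS (fun=> 1)) u * f =
          fps_comp (FPS (fun=> 1)) u * (1 - u).
  by rewrite /u subKr mulrAC mulrC [c * f]mulrC [f * c]mulrC.
apply/fpsP => n.
have -> : fpscoef (fps_comp (FPS (fun=> 1)) u * (1 - u)) n =
          fpscoef ((\sum_(i < n.+1) u ^+ i) * (1 - u)) n.
  rewrite !fpscoefM; apply: eq_bigr => j _; congr (_ * _).
  rewrite fpscoef_sum /= (eq_bigr (fun i : 'I__ => fpscoef (u ^+ i) j)).
    2: by move=> i _; rewrite mul1r.
  rewrite (big_ord_widen n.+1 (fun i => fpscoef (u ^+ i) j)) //.
  rewrite [RHS](bigID (fun i : 'I_n.+1 => (i < j.+1)%N)) /=.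
  rewrite [X in _ = _ + X]big1 ?addr0 // => i; rewrite -leqNgt => ji.
  exact: fpscoef_exp_small.
have -> : (\sum_(i < n.+1) u ^+ i) * (1 - u) = 1 - u ^+ n.+1.
  by rewrite mulrC -opprB mulNr -subrX1 opprB.
by rewrite fpscoefD /= fpscoef_exp_small // subr0.
Qed.

Fact fps_unitPl f g : g * f = 1 -> fps_unit f.
Proof.
move=> /fpsP/(_ 0%N); rewrite fpscoefM big_ord_recl big_ord0 addr0 subn0 => gf1.
by apply/unitrPr; exists (fpscoef g 0); rewrite mulrC.
Qed.

Fact fps_inv_out : {in [predC fps_unit], fps_inv =1 id}.
Proof. by move=> f fNU; rewrite /fps_inv ifN. Qed.

HB.instance Definition _ := GRing.ComNzRing_hasMulInverse.Build (fps A)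
  fps_mulVx fps_unitPl fps_inv_out.

End FpsUnitRing.

Definition map_fps (A B : Type) (h : A -> B) (f : fps A) : fps B :=
  FPS (fun n => h (fpscoef f n)).

Section Series.
Context {K : fieldType}.

(* log(1 + t) = \sum_(n >= 1) (-1)^(n-1) t^n / n *)
Definition fps_log1p : fps K :=
  FPS (fun n => if n is m.+1 then (-1) ^+ m / m.+1%:R else 0).

(* log(1 + t) / t has constant term 1, so it is invertible although
   log(1 + t) is not. *)
Definition fps_t_div_log1p : fps K :=
  (FPS (fun n => fpscoef fps_log1p n.+1))^-1.

Definition fps_Lif (k : int) : fps K :=
  FPS (fun n => (n`!%:R * n.+1%:R ^ k)^-1).

(* The binomial series (1 + t)^a = \sum_n 'C(a, n) t^n for a polynomial a. *)
Definition fps_1p_pow (a : {poly K}) : fps {poly K} :=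
  FPS (fun n => n`!%:R^-1 *: \prod_(i < n) (a - i%:R)).

(* The generating function is an element of K[x][[t]]; its factors that do not
   involve x are built in K[[t]]. *)
Definition A_genfun (r k : int) : fps {poly K} :=
  map_fps polyC (fps_t_div_log1p ^ r * fps_comp (fps_Lif k) fps_log1p)
    / fps_1p_pow 'X.

Definition A_poly (r k : int) (n : nat) : {poly K} :=
  n`!%:R *: fpscoef (A_genfun r k) n.

Definition A_num (r k : int) (n : nat) : K := (A_poly r k n).[0].

Definition rising_fact (m : nat) : {poly K} := \prod_(i < m) ('X + i%:R).

Lemma fps_t_div_log1pE : fps_t_div_log1p * fps_log1p = fpsX.
Proof.
set g := FPS (fun n => fpscoef fps_log1p n.+1).
have gU : g \is a GRing.unit.
  by rewrite unfold_in /= /fps_unit /= expr0 divr1 unitr1.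
have -> : fps_log1p = g * fpsX.
  apply/fpsP => -[|n].
    by rewrite fpscoefM big_ord_recl big_ord0 /= mulr0 addr0.
  rewrite fpscoefM big_ord_recr big_ord_recr /= subnn subSnn mulr0 mulr1 addr0.
  rewrite big1 ?add0r // => i _.
  by rewrite subSn ?(ltnW (ltn_ord i)) // eqSS subn_eq0 leqNgt ltn_ord mulr0.
by rewrite mulrA mulVr // mul1r.
Qed.

Lemma fps_1p_pow_unit (a : {poly K}) : fps_1p_pow a \is a GRing.unit.
Proof. by rewrite unfold_in /= /fps_unit /= big_ord0 invr1 scale1r unitr1. Qed.

End Series.

Arguments fps_log1p K : clear implicits.
Arguments fps_t_div_log1p K : clear implicits.
Arguments fps_Lif K k : clear implicits.
Arguments A_genfun K r k : clear implicits.
Arguments A_poly K r k n : clear implicits.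
Arguments A_num K r k n : clear implicits.
Arguments rising_fact K m : clear implicits.

(* Main.v *)
Require Import Defs.
From mathcomp Require Import all_boot all_order all_algebra.
From mathcomp Require Import ring reals complex.

(** The generating function is g(t) (1 + t)^(-x) with g free of x. Since
    (1 + t)^a (1 + t)^b = (1 + t)^(a + b), the second factor is the binomial
    series of exponent -x, whose coefficients are (-1)^m x^(m) / m!, so
    A_n(x) is a binomial convolution of the numbers n! g_n with the rising
    factorials; at x = 0 only the term m = 0 survives and A_n(0) = n! g_n. *)

Set Implicit Arguments.
Unset Strict Implicit.
Unset Printing Implicit Defensive.

Import GRing.Theory Num.Theory.
Local Open Scope ring_scope.

Section CharZero.
Variables (K : fieldType) (K_pchar0 : has_pchar0 K).

Lemma natrS_neq0 n : n.+1%:R != 0 :> K.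
Proof. by rewrite ((pcharf0P K).1 K_pchar0). Qed.

Lemma fact_neq0 n : n`!%:R != 0 :> K.
Proof. by rewrite -(prednK (fact_gt0 n)) natrS_neq0. Qed.

Lemma fps_1p_pow0 (a : {poly K}) : fpscoef (fps_1p_pow a) 0 = 1.
Proof. by rewrite /= big_ord0 invr1 scale1r. Qed.

(* The coefficientwise form of (1 + t) f' = a f. *)
Lemma fps_1p_powS (a : {poly K}) n :
  n.+1%:R * fpscoef (fps_1p_pow a) n.+1 =
  (a - n%:R) * fpscoef (fps_1p_pow a) n.
Proof.
rewrite /= big_ord_recr /= -!scalerAr mulr_natl -scaler_nat scalerA.
rewrite [_ * (a - _)]mulrC.
by congr (_ *: _); rewrite factS natrM invfM mulrAC mulVf ?mul1r ?natrS_neq0.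
Qed.

(** Leibniz rule for [(1 + t) d/dt]: if [(1 + t) f' = a f] and [(1 + t) g' = b g], then
    [(1 + t) (f g)' = (a + b) f g]. *)
Lemma fps_1p_powM_rec (a b : {poly K}) n :
  n.+1%:R * fpscoef (fps_1p_pow a * fps_1p_pow b) n.+1 =
  (a + b - n%:R) * fpscoef (fps_1p_pow a * fps_1p_pow b) n.
Proof.
rewrite !fpscoefM; set P := fpscoef _; set Q := fpscoef _.
(* Split the weight as [n + 1 = i + (n + 1 - i)], one part for each factor. *)
transitivity (\sum_(i < n.+2) i%:R * P i * Q (n.+1 - i)%N +
              \sum_(i < n.+2) P i * ((n.+1 - i)%:R * Q (n.+1 - i)%N)).
  rewrite -big_split mulr_sumr; apply: eq_bigr => i _ /=.
  rewrite -[X in X%:R * _](@subnKC i) -1?ltnS // natrD mulrDl mulrA.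
  by rewrite [P i * (_ * _)]mulrCA.
(* The terms of weight zero, [i = 0] in the first sum and [i = n + 1] in the second, drop out. After
   a shift both sums run over [i <= n], and [(a - i) + (b - (n - i)) = a + b - n]. *)
rewrite big_ord_recl !mul0r add0r [X in _ + X]big_ord_recr /=.
rewrite subnn mul0r mulr0 addr0 -big_split mulr_sumr; apply: eq_bigr => i _ /=.
rewrite /bump add1n subSS fps_1p_powS subSn -1?ltnS // fps_1p_powS.
rewrite [P i * (_ * _)]mulrCA -!mulrA -mulrDl.
by congr (_ * _); rewrite natrB -1?ltnS //; ring.
Qed.

(** Both sides have constant term 1 and obey the same first-order recurrence, whose leading factor
    [n + 1] can be cancelled in characteristic zero. *)
Lemma fps_1p_powD (a b : {poly K}) :
  fps_1p_pow (a + b) = fps_1p_pow a * fps_1p_pow b.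
Proof.
apply/fpsP; elim=> [|n IHn].
  by rewrite fpscoefM big_ord1 !fps_1p_pow0 mulr1.
have nz : n.+1%:R != 0 :> {poly K} by rewrite -polyC_natr polyC_eq0 natrS_neq0.
by apply: (mulfI nz); rewrite fps_1p_powS fps_1p_powM_rec IHn.
Qed.

Lemma fps_1p_pow_exp0 : fps_1p_pow (0 : {poly K}) = 1.
Proof.
apply/fpsP => -[|n]; first exact: fps_1p_pow0.
by rewrite /= big_ord_recl subrr mul0r scaler0.
Qed.

Lemma fps_1p_powN (a : {poly K}) : (fps_1p_pow a)^-1 = fps_1p_pow (- a).
Proof.
apply: (mulrI (fps_1p_pow_unit a)).
by rewrite divrr ?fps_1p_pow_unit // -fps_1p_powD subrr fps_1p_pow_exp0.
Qed.

Lemma fpscoef_1p_powNX m :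
  fpscoef (fps_1p_pow (- 'X)) m = ((-1) ^+ m / m`!%:R) *: rising_fact K m.
Proof.
rewrite /= mulrC -scalerA; congr (_ *: _).
rewrite (eq_bigr (fun i : 'I_m => - ('X + i%:R))); last first.
  by move=> i _; rewrite opprD.
by rewrite prodrN card_ord -mul_polyC rmorph_sign.
Qed.

Lemma rising_fact_horner0 m : (rising_fact K m).[0] = (m == 0%N)%:R.
Proof.
case: m => [|m]; first by rewrite /rising_fact big_ord0 hornerC.
by rewrite /rising_fact big_ord_recl addr0 hornerM hornerX mul0r.
Qed.

(** Stated with the coefficients of [g] because [A_numE], which identifies them with the numbers
    [A_num], is itself the value of this expansion at 0. *)
Lemma A_poly_conv (r k : int) n (g := fps_t_div_log1p K ^ r *
    fps_comp (fps_Lif K k) (fps_log1p K)) :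
  A_poly K r k n = \sum_(m < n.+1)
    ((-1) ^+ m * 'C(n, m)%:R * ((n - m)`!%:R * fpscoef g (n - m))) *:
      rising_fact K m.
Proof.
rewrite /A_poly /A_genfun fps_1p_powN -/g [_ * fps_1p_pow _]mulrC fpscoefM.
rewrite scaler_sumr; apply: eq_bigr => m _.
rewrite fpscoef_1p_powNX mulrC mul_polyC !scalerA; congr (_ *: _).
(* Write [n!] as ['C(n, m) * (m! * (n - m)!)]; the [m!] cancels the denominator of the binomial
   series. *)
rewrite -(bin_fact (leq_ord m)) !natrM.
have := fact_neq0 m; set f := _%:R => f0.
by set e := (-1) ^+ m; field.
Qed.

Lemma A_numE (r k : int) n :
  A_num K r k n = n`!%:R * fpscoef (fps_t_div_log1p K ^ r *
    fps_comp (fps_Lif K k) (fps_log1p K)) n.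
Proof.
rewrite /A_num A_poly_conv horner_sum big_ord_recl big1 => [|i _].
  by rewrite hornerZ rising_fact_horner0 bin0 subn0 expr0 !mul1r mulr1 addr0.
by rewrite hornerZ rising_fact_horner0 mulr0.
Qed.

End CharZero.

Theorem theorem2p8 (R : realType) (n : nat) (r k : int) :
  A_poly R[i] r k n =
  \sum_(m < n.+1)
    ((-1) ^+ m * 'C(n, m)%:R * A_num R[i] r k (n - m)) *: rising_fact R[i] m.
Proof.
have pchar0 : has_pchar0 R[i] by exact: pchar_num.
rewrite A_poly_conv //; apply: eq_bigr => m _.
by rewrite A_numE.
Qed.
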